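(* Let $(\phi,\{\mathbf{w}_{u,k}\})$ be an optimal solution of $\mathcal{P}_{\mathrm{primal}}$ and $\{\mu_k\},\{\lambda_{u,k}/N_t\}$ corresponding optimal Lagrange multipliers (see the context). If, for some user $u$ of cell $k$, the optimal matrix $\boldsymbol\Sigma_{u,k}$ is nonsingular, then the optimal $\lambda_{u,k}$ is strictly positive and satisfies $$\lambda_{u,k}=\frac{\gamma_k}{\frac1{N_t}\mathbf{h}_{u,k,k}\boldsymbol\Sigma_{u,k}^{-1}\mathbf{h}_{u,k,k}^H},$$ and the optimal $\mathbf{w}_{u,k}$ is of the form $\mathbf{w}_{u,k}=\delta_{u,k}\boldsymbol\Sigma_{u,k}^{-1}\mathbf{h}_{u,k,k}^H$ for some scalar $\delta_{u,k}$.
   Context: There are $L$ cells; base station (BS) $k$ has $N_t$ antennas and serves $U_k$ single-antenna users. The channel from BS $k$ to user $u$ of cell $j$ is a row vector $\mathbf{h}_{u,j,k}\in\mathbb{C}^{1\times N_t}$. Let $\sigma^2>0$, $P>0$ and target SINRs $\gamma_k>0$ be given. For beamforming vectors $\mathbf{w}_{u,k}\in\mathbb{C}^{N_t}$, $$\mathrm{SINR}_{u,k}=\frac{|\mathbf{h}_{u,k,k}\mathbf{w}_{u,k}|^2}{\sigma^2+\sum_{(u',j)\ne(u,k)}|\mathbf{h}_{u,k,j}\mathbf{w}_{u',j}|^2}.$$ $\mathcal{P}_{\mathrm{primal}}$: minimize $\phi\sum_{k=1}^LP$ over $\phi,\{\mathbf{w}_{u,k}\}$ subject to $\sum_{u=1}^{U_k}\|\mathbf{w}_{u,k}\|^2\le\phi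 P$ for all $k$, and $\mathrm{SINR}_{u,k}\ge\gamma_k$ for all $u,k$, where one may and does impose that $\mathbf{h}_{u,k,k}\mathbf{w}_{u,k}$ is real and strictly positive. The target SINRs are assumed achievable (with some finite power), so that Slater's condition holds for the equivalent convex (second-order cone) formulation, strong duality holds, and the KKT conditions are necessary and sufficient. The multiplier of the power constraint at BS $k$ is $\mu_k\ge0$, and $\lambda_{u,k}/N_t\ge0$ is the multiplier of the SINR constraint written as $\frac1{\gamma_k}|\mathbf{h}_{u,k,k}\mathbf{w}_{u,k}|^2\ge\sigma^2+\sum_{(\bar u,j)\ne(u,k)}|\mathbf{h}_{u,k,j}\mathbf{w}_{\bar u,j}|^2$. Put $$\boldsymbol\Sigma_{u,k}=\mu_k\mathbf{I}+\sum_{(\bar u,j)\ne(u,k)}\frac{\lambda_{\bar u,j}}{N_t}\mathbf{h}_{\bar u,j,k}^H\mathbf{h}_{\bar u,j,k}.$$ The KKT conditions are: stationarity $\left[\boldsymbol\Sigma_{u,k}-\frac{\lambda_{u,k}}{\gamma_kN_t}\mathbf{h}_{u,k,k}^H\mathbf{h}_{u,k,k}\right]\mathbf{w}_{u,k}=\mathbf{0}$ for all $u,k$ and $\sum_k(1-\mu_k)=0$; primal feasibility; $\mu_k,\lambda_{u,k}\ge0$; and complementary slackness for the power and SINR constraints. *)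

(* Defs.v *)
From mathcomp Require Import all_boot all_order all_algebra.
From mathcomp Require Import spectral complex reals.

Set Implicit Arguments.
Unset Strict Implicit.
Unset Printing Implicit Defensive.

Import Order.TTheory GRing.Theory Num.Theory.

Local Open Scope ring_scope.
Local Open Scope complex_scope.
Local Open Scope sesquilinear_scope.

(* A user is a pair (k, u) of a cell k and an index u < U k; [tag i] is the cell
   (equivalently, the serving base station) of the user i. *)
Definition user (L : nat) (U : 'I_L -> nat) : Type := {k : 'I_L & 'I_(U k)}.

Section Downlink.

Context {R : realType} {L Nt : nat} {U : 'I_L -> nat}.

(* [h i k] is the channel from base station k to the user i, i.e. h_{u,j,k} for
   i = (j, u); it is a row vector. *)
Variable h : user U -> 'I_L -> 'rV[R[i]]_Nt.
Variables (sigma2 P : R) (gamma : 'I_L -> R).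

Definition abs2 (z : R[i]) : R := ComplexField.Normc.normc z ^+ 2.

(* The squared Euclidean norm (the library norm on matrices is the sup norm). *)
Definition norm2 (v : 'cV[R[i]]_Nt) : R := \sum_(a < Nt) abs2 (v a 0).

Definition gain (w : user U -> 'cV[R[i]]_Nt) (i j : user U) : R[i] :=
  (h i (tag j) *m w j) 0 0.

Definition interference (w : user U -> 'cV[R[i]]_Nt) (i : user U) : R :=
  \sum_(j : user U | j != i) abs2 (gain w i j).

Definition SINR (w : user U -> 'cV[R[i]]_Nt) (i : user U) : R :=
  abs2 (gain w i i) / (sigma2 + interference w i).

Definition bs_power (w : user U -> 'cV[R[i]]_Nt) (k : 'I_L) : R :=
  \sum_(u < U k) norm2 (w (Tagged (fun j => 'I_(U j)) u)).

(* In R[i], 0 < z means that z is real and strictly positive. *)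
Definition primal_feasible (phi : R) (w : user U -> 'cV[R[i]]_Nt) : Prop :=
  [/\ forall k : 'I_L, bs_power w k <= phi * P,
      forall i : user U, gamma (tag i) <= SINR w i
    & forall i : user U, 0 < gain w i i].

Definition primal_objective (phi : R) : R := phi * \sum_(k < L) P.

Definition primal_optimal (phi : R) (w : user U -> 'cV[R[i]]_Nt) : Prop :=
  primal_feasible phi w /\
  forall (phi' : R) (w' : user U -> 'cV[R[i]]_Nt),
    primal_feasible phi' w' -> primal_objective phi <= primal_objective phi'.

(* [lambda i / Nt], not [lambda i], is the multiplier of the SINR constraint. *)
Definition Sigma (mu : 'I_L -> R) (lambda : user U -> R) (i : user U) :
    'M[R[i]]_Nt :=
  (mu (tag i))%:C%:M +
  \sum_(j : user U | j != i)
     (lambda j / Nt%:R)%:C *: ((h j (tag i)) ^t* *m h j (tag i)).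

Record KKT (phi : R) (w : user U -> 'cV[R[i]]_Nt)
    (mu : 'I_L -> R) (lambda : user U -> R) : Prop := {
  KKT_stationary_w : forall i : user U,
    (Sigma mu lambda i
     - (lambda i / (gamma (tag i) * Nt%:R))%:C
         *: ((h i (tag i)) ^t* *m h i (tag i))) *m w i = 0;
  KKT_stationary_phi : \sum_(k < L) (1 - mu k) = 0;
  KKT_primal : primal_feasible phi w;
  KKT_mu_ge0 : forall k : 'I_L, 0 <= mu k;
  KKT_lambda_ge0 : forall i : user U, 0 <= lambda i;
  KKT_slack_power : forall k : 'I_L, mu k * (phi * P - bs_power w k) = 0;
  KKT_slack_SINR : forall i : user U,
    lambda i / Nt%:R *
      ((gamma (tag i))^-1 * abs2 (gain w i i)
       - (sigma2 + interference w i)) = 0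
}.

End Downlink.

(* Main.v *)
(* If S w = c h^H (h w) with S invertible and h w <> 0, then
   w = c (h w) S^-1 h^H; multiplying by h on the left and cancelling h w gives
   c (h S^-1 h^H) = 1.  Here c = lambda / (gamma Nt), so lambda <> 0. *)

Require Import Defs.
From mathcomp Require Import all_boot all_order all_algebra.
From mathcomp Require Import spectral complex reals.

Import Order.TTheory GRing.Theory Num.Theory.

Local Open Scope ring_scope.
Local Open Scope complex_scope.
Local Open Scope sesquilinear_scope.

(** The column [b] plays the part of [h^H] but stays independent of [h], so the argument is linear
    algebra over any field, without conjugation. *)
Lemma rank1_pencil_kernel {F : fieldType} {n : nat} {S : 'M[F]_n}
    {h : 'rV[F]_n} {b w : 'cV[F]_n} {c : F} :
  S \in unitmx -> (S - c *: (b *m h)) *m w = 0 ->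
  w = (c * (h *m w) 0 0) *: (invmx S *m b).
Proof.
move=> Su /eqP; rewrite mulmxBl subr_eq0 => /eqP Sw.
(* The 1 x 1 matrix [h *m w] acts on [b] as a scalar. *)
rewrite -[LHS](mulKmx Su) Sw -scalemxAl -mulmxA {1}[h *m w]mx11_scalar.
by rewrite mul_mx_scalar -!scalemxAr scalerA.
Qed.

Lemma rank1_pencil_coef {F : fieldType} {n : nat} {S : 'M[F]_n}
    {h : 'rV[F]_n} {b w : 'cV[F]_n} {c : F} :
  S \in unitmx -> (S - c *: (b *m h)) *m w = 0 -> (h *m w) 0 0 != 0 ->
  c * (h *m invmx S *m b) 0 0 = 1.
Proof.
move=> Su /(rank1_pencil_kernel Su) wE g0; apply: (mulfI g0).
(* Since [w] occurs on both sides of [wE], it is expanded only on the right; the factor [h *m w] on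
   the left must survive. *)
rewrite mulr1 [RHS](congr1 (fun v => (h *m v) 0 0) wE).
by rewrite -scalemxAr mulmxA [RHS]mxE mulrCA mulrA.
Qed.

Theorem lemma1 (R : realType) (L Nt : nat) (U : 'I_L -> nat)
    (h : user U -> 'I_L -> 'rV[R[i]]_Nt)
    (sigma2 P : R) (gamma : 'I_L -> R)
    (sigma2_gt0 : 0 < sigma2) (P_gt0 : 0 < P)
    (gamma_gt0 : forall k : 'I_L, 0 < gamma k)
    (phi : R) (w : user U -> 'cV[R[i]]_Nt)
    (mu : 'I_L -> R) (lambda : user U -> R)
    (w_opt : primal_optimal h sigma2 P gamma phi w)
    (mult_opt : KKT h sigma2 P gamma phi w mu lambda)
    (k : 'I_L) (u : 'I_(U k)) :
  let i : user U := Tagged (fun j => 'I_(U j)) u in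
  let S : 'M[R[i]]_Nt := Sigma h mu lambda i in
  S \in unitmx ->
  [/\ 0 < lambda i,
      (lambda i)%:C =
        (gamma k)%:C / (Nt%:R^-1 * (h i k *m invmx S *m (h i k) ^t*) 0 0)
    & exists delta : R[i], w i = delta *: (invmx S *m (h i k) ^t*)].
Proof.
move=> i S Su.
have stat := KKT_stationary_w mult_opt i.
have [_ _ gain_gt0] := KKT_primal mult_opt.
have gain_neq0 : (h i k *m w i) 0 0 != 0 by rewrite gt_eqF // (gain_gt0 i).
have cq1 := rank1_pencil_coef Su stat gain_neq0.
have wE := rank1_pencil_kernel Su stat.
set c := lambda i / (gamma k * Nt%:R) in cq1 wE.
have c_neq0 : c != 0.
  by apply: contra_eq_neq cq1 => ->; rewrite mul0r eq_sym oner_neq0.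
(* The inverse of 0 is 0, so [c != 0] forces the denominator to be nonzero as well; in particular
   [Nt] is positive. *)
have [lambda_neq0 gammaNt_neq0] : lambda i != 0 /\ gamma k * Nt%:R != 0.
  by move: c_neq0; rewrite mulf_eq0 invr_eq0 negb_or => /andP.
split; last by eexists; exact: wE.
  by rewrite lt0r lambda_neq0 (KKT_lambda_ge0 mult_opt).
(* The quadratic form is thus real, and the claim reduces to the identity
   [lambda i = gamma k * Nt * c] in [R]. *)
have -> : (h i k *m invmx S *m (h i k) ^t*) 0 0 = (c^-1)%:C.
  by rewrite fmorphV; exact/esym/mulr1_eq.
rewrite -(rmorph_nat (real_complex R)) -fmorphV -rmorphM -fmorphV -rmorphM.
by congr (_ %:C); rewrite invfM !invrK mulrA mulrC divfK.
Qed.
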